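(* Let $y$ be a nonnegative integer and $x\in\mathbb{R}$. Let $Star_y$ be the graph with vertices $v_0,v_1,\dots,v_y$, edges $v_0v_i$ for $1\le i\le y$, and a loop at every vertex. Define vertex weights $\alpha(v_0)=1$, $\alpha(v_i)=x$ for $i\ge1$, and edge weights $\beta\equiv 1$. Then for every finite simple graph $G=(V,E)$, \[ Q(G;x,y)=\sum_{h:V\to V(Star_y)\ \text{homomorphism}}\ \prod_{v\in V}\alpha(h(v))\prod_{\{u,v\}\in E}\beta(h(u),h(v)). \]
   Context: For a finite simple graph $G=(V,E)$, $Q(G;x,y)=\sum_{X\subseteq V}x^{|X|}y^{k(G[X])}$, where $G[X]$ is the induced subgraph, $k$ is the number of connected components (the null graph has $k=0$), and $0^0=1$. A homomorphism $h:V\to V(Star_y)$ is a map sending adjacent vertices to adjacent vertices of $Star_y$ (loops allowed, so adjacent vertices may map to the same vertex). *)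

(* Defs.v *)
From HB Require Import structures.
From mathcomp Require Import all_boot all_order all_algebra.
From mathcomp Require Import reals.

Set Implicit Arguments.
Unset Strict Implicit.
Unset Printing Implicit Defensive.

Import GRing.Theory.
Local Open Scope ring_scope.

(* Finite undirected graphs without parallel edges; loops are allowed, so that
   the same type serves for simple graphs and for the target of
   homomorphisms. *)
Record graph := Graph {
  vertex :> finType;
  adj : rel vertex;
  adj_sym : symmetric adj
}.

Definition simple (G : graph) : Prop := irreflexive (adj (g := G)).

(* An edge is the set of its endpoints; a loop is a singleton. *)
Definition edges (G : graph) : {set {set G}} :=
  [set e | [exists u, exists v, adj u v && (e == [set u; v])]].

Definition induced_adj (G : graph) (X : {set G}) : rel {v : G | v \in X} :=
  fun u v => adj (val u) (val v).

Lemma induced_adj_sym (G : graph) (X : {set G}) : symmetric (@induced_adj G X).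
Proof. by move=> u v; rewrite /induced_adj adj_sym. Qed.

Definition induced (G : graph) (X : {set G}) : graph :=
  Graph (@induced_adj_sym G X).

Definition components (G : graph) : nat := n_comp (adj (g := G)) [set: G].

(* 0 ^+ 0 = 1 in any ring. *)
Definition subgraph_component_poly (R : realType) (G : graph) (x y : R) : R :=
  \sum_(X : {set G}) x ^+ #|X| * y ^+ components (induced X).

Definition homomorphism (G H : graph) (h : {ffun G -> H}) : bool :=
  [forall u, forall v, adj u v ==> adj (h u) (h v)].

(* Edge weights are functions of unordered pairs: for e = [set u; v], the
   image h @: e is [set h u; h v], so beta (h @: e) is beta(h(u), h(v)). *)
Definition weighted_hom_sum (R : realType) (G H : graph)
    (alpha : H -> R) (beta : {set H} -> R) : R :=
  \sum_(h : {ffun G -> H} | homomorphism h)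
     (\prod_(v : G) alpha (h v)) * \prod_(e in edges G) beta (h @: e).

(* The vertex v_i is i : 'I_y.+1, so the centre v_0 is ord0. *)
Definition star_adj (y : nat) : rel 'I_y.+1 :=
  fun i j => [|| i == j, i == ord0 | j == ord0].

Lemma star_adj_sym (y : nat) : symmetric (@star_adj y).
Proof. by move=> i j; rewrite /star_adj eq_sym; do !case: (_ == _). Qed.

Definition Star (y : nat) : graph := Graph (@star_adj_sym y).

Definition star_vertex_weight (R : realType) (y : nat) (x : R) (v : Star y) : R :=
  if v == ord0 :> 'I_y.+1 then 1 else x.

Definition star_edge_weight (R : realType) (y : nat) (e : {set Star y}) : R := 1.

(* Main.v *)
(* Sort the homomorphisms h into Star_y by the set X of vertices that h does
   not send to the centre.  Distinct leaves are not adjacent, so those with a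
   given X are exactly the functions X -> {v_1, ..., v_y} that are constant on
   the components of G[X]; there are y^k(G[X]) of them, each of weight x^|X|. *)
Require Import Defs.
From HB Require Import structures.
From mathcomp Require Import all_boot all_order all_algebra.
From mathcomp Require Import reals.

Set Implicit Arguments.
Unset Strict Implicit.
Unset Printing Implicit Defensive.

Import GRing.Theory.
Local Open Scope ring_scope.

(** Constancy on connected components, phrased through single edges so that it compares directly
    with [homomorphism]. *)
Definition locally_constant (G : graph) (T : eqType) (f : {ffun G -> T}) : bool :=
  [forall u, forall v, adj u v ==> (f u == f v)].

Lemma locally_constantP (G : graph) (T : eqType) (f : {ffun G -> T}) :
  reflect (forall u v : G, adj u v -> f u = f v) (locally_constant f).
Proof.
apply: (iffP forallP) => [fP u v uv|fP u].
  by move/forallP/(_ v)/implyP: (fP u) => /(_ uv)/eqP.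
by apply/forallP => v; apply/implyP => /fP ->.
Qed.

Lemma homomorphismP (G H : graph) (h : {ffun G -> H}) :
  reflect (forall u v : G, adj u v -> adj (h u) (h v)) (homomorphism h).
Proof.
apply: (iffP forallP) => [hP u v uv|hP u].
  by move/forallP/(_ v)/implyP: (hP u) => /(_ uv).
by apply/forallP => v; apply/implyP => /hP.
Qed.

Lemma adj_connect_sym (G : graph) : connect_sym (adj (g := G)).
Proof. exact/sym_connect_sym/adj_sym. Qed.

Lemma locally_constant_connect (G : graph) (T : eqType) (f : {ffun G -> T})
    (u v : G) :
  locally_constant f -> connect (adj (g := G)) u v -> f u = f v.
Proof.
move=> /locally_constantP fP /connectP[p]; elim: p u => [|w p IHp] u /= => [_ ->//|].
by move=> /andP[/fP-> /IHp]; apply.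
Qed.

(** Each component has one canonical representative, its [root]; values at the roots can be
    prescribed freely and determine the function. *)
Lemma card_locally_constant (G : graph) (T : finType) :
  #|[set f : {ffun G -> T} | locally_constant f]| = (#|T| ^ components G)%N.
Proof.
pose e := adj (g := G).
have rootsP v : fingraph.roots e (fingraph.root e v) by apply: roots_root; apply: adj_connect_sym.
pose ext (g : {ffun {r | fingraph.roots e r} -> T}) : {ffun G -> T} :=
  [ffun v => g (Sub (fingraph.root e v) (rootsP v))].
have ext_inj : injective ext.
  move=> g1 g2 /ffunP eq_g; apply/ffunP => r.
  (* A root is its own root, so [ext g] takes the value [g r] there. *)
  have := eq_g (val r); rewrite !ffunE.
  suff -> : Sub (fingraph.root e (val r)) (rootsP (val r)) = r by [].
  by apply/val_inj => /=; apply/eqP; case: r.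
have <- : #|{: {r | fingraph.roots e r}}| = components G.
  rewrite card_sig; apply: eq_card => v.
  by rewrite !inE andbT.
rewrite -card_ffun -cardsT -(card_imset _ ext_inj); congr #|pred_of_set _|.
apply/setP => f; rewrite inE; apply/idP/imsetP => [fP|[g _ ->]].
  (* The preimage is the restriction of [f] to the roots. *)
  exists [ffun r => f (val r)] => //; apply/ffunP => v; rewrite !ffunE /=.
  by apply: locally_constant_connect => //; apply: connect_root.
apply/locally_constantP => u v uv; rewrite !ffunE; congr (g _); apply/val_inj => /=.
by apply/eqP; rewrite root_connect ?connect1 //; apply: adj_connect_sym.
Qed.

Definition leaf_support (G : graph) (y : nat) (h : {ffun G -> Star y}) : {set G} :=
  [set v | h v != ord0 :> 'I_y.+1].

Lemma card_star_homomorphism (G : graph) (y : nat) (X : {set G}) :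
  #|[set h : {ffun G -> Star y} | homomorphism h && (leaf_support h == X)]|
  = (y ^ components (induced X))%N.
Proof.
rewrite -[y in (y ^ _)%N]card_ord -card_locally_constant.
(* [lift ord0] identifies ['I_y] with the leaves; vertices outside [X] go to the centre. *)
pose ext (f : {ffun induced X -> 'I_y}) : {ffun G -> Star y} :=
  [ffun v => if insub v is Some w then lift ord0 (f w) else ord0 : 'I_y.+1].
have extE f (w : {v | v \in X}) : ext f (val w) = lift ord0 (f w).
  by rewrite ffunE valK.
have ext0 f v : v \notin X -> ext f v = ord0.
  by move=> vX; rewrite ffunE insubN.
have ext_inj : injective ext.
  move=> f1 f2 /ffunP eq_f; apply/ffunP => w.
  by have := eq_f (val w); rewrite !extE => /lift_inj.
rewrite -(card_imset _ ext_inj); congr #|pred_of_set _|.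
apply/setP => h; rewrite inE; apply/idP/imsetP => [/andP[hP /eqP suppX]|[f]].
  have h0 (v : G) : (v \in X) = (h v != ord0 :> 'I_y.+1) by rewrite -suppX inE.
  (* An informative sigma type, so that the leaf index can be extracted as a function of [w]. *)
  have hX (w : {v | v \in X}) : {i : 'I_y | h (val w) = lift ord0 i}.
    have := valP w; rewrite h0 eq_sym => /unlift_some[i hi _].
    by exists i.
  exists [ffun w : induced X => sval (hX w)].
    rewrite inE; apply/locally_constantP => u v uv; rewrite !ffunE.
    case: (hX u) (hX v) => i hi [j hj] /=.
    have := homomorphismP _ hP _ _ uv.
    (* Neither image is the centre, so adjacency in the star leaves only equality. *)
    by rewrite hi hj /= /star_adj /= !orbF => /eqP/lift_inj.
  apply/ffunP => v; have [vX|vX] := boolP (v \in X).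
    by rewrite -[v]/(val (Sub v vX : {v | v \in X})) extE ffunE; case: (hX _).
  by rewrite ext0 //; apply/eqP; rewrite h0 negbK in vX.
rewrite inE => /locally_constantP fP ->; apply/andP; split.
  apply/homomorphismP => u v uv; rewrite /= /star_adj.
  (* The centre is adjacent to every vertex, itself included, so only edges inside [X] impose a
     condition. *)
  have [uX|uX] := boolP (u \in X); last by rewrite (ext0 _ _ uX) eqxx orbT.
  have [vX|vX] := boolP (v \in X); last by rewrite (ext0 _ _ vX) eqxx !orbT.
  rewrite -[u]/(val (Sub u uX : {v | v \in X})).
  rewrite -[v]/(val (Sub v vX : {v | v \in X})) !extE.
  by rewrite (fP (Sub u uX) (Sub v vX)) ?eqxx.
apply/eqP/setP => v; rewrite inE; have [vX|vX] := boolP (v \in X).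
  by rewrite -[v]/(val (Sub v vX : {v | v \in X})) extE.
by rewrite ext0 ?eqxx.
Qed.

Lemma prod_star_vertex_weight (R : realType) (G : graph) (y : nat) (x : R)
    (h : {ffun G -> Star y}) :
  \prod_(v : G) star_vertex_weight x (h v) = x ^+ #|leaf_support h|.
Proof.
rewrite -prodr_const [RHS]big_mkcond; apply: eq_bigr => v _.
by rewrite inE /star_vertex_weight; case: eqP.
Qed.

Theorem theorem4p3 (R : realType) (y : nat) (x : R) (G : graph)
    (simpleG : simple G) :
  subgraph_component_poly G x y%:R =
  weighted_hom_sum G (@star_vertex_weight R y x) (@star_edge_weight R y).
Proof.
rewrite /weighted_hom_sum (partition_big (@leaf_support G y) predT) //=.
apply: eq_bigr => X _.
rewrite (eq_bigr (fun=> x ^+ #|X|)) => [|h /andP[_ /eqP <-]]; last first.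
  by rewrite prod_star_vertex_weight [X in _ * X]big1 ?mulr1.
(* The summand no longer depends on [h], so the inner sum is [x ^+ #|X|] times the number of
   homomorphisms with support [X]. *)
by rewrite -big_set sumr_const card_star_homomorphism -natrX mulr_natr.
Qed.
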